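(* Let $n\geq 1$ and $m\geq 1$ with $(n,m)\notin\{(1,1),(1,2),(2,1)\}$. Then there exists an $n\times m$ min-$2$TDS matrix $M$ such that either $M=B(3,3)$ up to permutations of rows and columns, or every component of $M$, up to permutations of rows and columns, is one of: $J(x,1)$ with $x\geq 3$, $J(1,y)$ with $y\geq 3$, $J(x,2)$ with $x\geq 2$, or $J(2,y)$ with $y\geq 2$.
   Context: For an $n\times m$ $(0,1)$-matrix $M=(m_{ij})$, define $\kappa(i,j)$ as the $i$-th row sum plus the $j$-th column sum minus $2m_{ij}$; $M$ is a $k$TDS matrix if $\kappa(i,j)\geq k$ for all cells. A min-$k$TDS matrix is an $n\times m$ $k$TDS matrix whose number of ones is the minimum possible among all $n\times m$ $k$TDS matrices (this minimum equals $\gamma_{\times k,t}(K_n\Box K_m)$, the $k$-tuple total domination number of the rook's graph). Given $M$, let $\Gamma(M)$ be the graph whose vertices are the positions of the ones of $M$, two ones adjacent iff they lie in the same row or column with no other one strictly between them. The components of $M$ are the connected components of $\Gamma(M)$, each identified with the submatrix of $M$ on the rows and columns its ones meet. $J(x,y)$ denotes the $x\times y$ all-ones matrix; $B(3,3)$ is the $3\times 3$ $(0,1)$-matrix whose first row and first column are all ones and all other entries are $0$. *)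

(* Defs.v *)
From mathcomp Require Import all_boot all_order all_algebra.

Set Implicit Arguments.
Unset Strict Implicit.
Unset Printing Implicit Defensive.

(* A (0,1)-matrix is a boolean matrix; entries are read as naturals through
   the coercion from bool to nat. *)

Definition row_sum n m (M : 'M[bool]_(n, m)) (i : 'I_n) : nat :=
  \sum_(j < m) M i j.

Definition col_sum n m (M : 'M[bool]_(n, m)) (j : 'I_m) : nat :=
  \sum_(i < n) M i j.

(* The subtraction never truncates: M i j is a summand of both the row sum
   and the column sum. *)
Definition kappa n m (M : 'M[bool]_(n, m)) (i : 'I_n) (j : 'I_m) : nat :=
  row_sum M i + col_sum M j - 2 * M i j.

Definition kTDS (k n m : nat) (M : 'M[bool]_(n, m)) : Prop :=
  forall i j, k <= kappa M i j.

Definition num_ones n m (M : 'M[bool]_(n, m)) : nat :=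
  \sum_(i < n) \sum_(j < m) M i j.

Definition min_kTDS (k n m : nat) (M : 'M[bool]_(n, m)) : Prop :=
  kTDS k M /\
  forall M' : 'M[bool]_(n, m), kTDS k M' -> num_ones M <= num_ones M'.

Definition ones n m (M : 'M[bool]_(n, m)) : finType :=
  {p : 'I_n * 'I_m | M p.1 p.2}.

Definition strictly_between (a b c : nat) : bool :=
  (a < b < c) || (c < b < a).

(* Edge relation of Gamma(M). *)
Definition Gamma n m (M : 'M[bool]_(n, m)) : rel (ones M) := fun u v =>
  let: (i, j) := val u in
  let: (i', j') := val v in
  [|| [&& i == i', j != j' &
          [forall l : 'I_m, strictly_between j l j' ==> ~~ M i l]]
    | [&& j == j', i != i' &
          [forall l : 'I_n, strictly_between i l i' ==> ~~ M l j]]].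

Definition components n m (M : 'M[bool]_(n, m)) : {set {set ones M}} :=
  equivalence_partition (connect (Gamma (M := M))) [set: ones M].

Definition comp_rows n m (M : 'M[bool]_(n, m)) (C : {set ones M}) : {set 'I_n} :=
  [set (val u).1 | u in C].

Definition comp_cols n m (M : 'M[bool]_(n, m)) (C : {set ones M}) : {set 'I_m} :=
  [set (val u).2 | u in C].

Definition comp_mx n m (M : 'M[bool]_(n, m)) (C : {set ones M}) :
    'M[bool]_(#|comp_rows C|, #|comp_cols C|) :=
  mxsub (@enum_val _ (mem (comp_rows C))) (@enum_val _ (mem (comp_cols C))) M.

(* Equality up to permutations of rows and columns. The formats are allowed to
   differ syntactically; the bijections force n = p and m = q. *)
Definition perm_equiv n m p q (A : 'M[bool]_(n, m)) (B : 'M[bool]_(p, q)) : Prop :=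
  exists (f : 'I_p -> 'I_n) (g : 'I_q -> 'I_m),
    [/\ bijective f, bijective g & mxsub f g A = B].

Definition J (x y : nat) : 'M[bool]_(x, y) := const_mx true.

Definition B33 : 'M[bool]_(3, 3) :=
  \matrix_(i, j) ((i == ord0) || (j == ord0)).

(* Main.v *)
(* Let n, m >= 2 and take an n x m 2TDS matrix with the minimal number e of ones.
   A zero row (column) forces all column (row) sums to be at least 2, and then
   two full rows (columns) are optimal.  Otherwise only the cells holding a one
   matter: their row and column sums add up to at least 4.  Counting the ones
   along rows, along columns, and around the rows and columns of sum 1 gives
   four inequalities whose sum is 4 e >= 3 (n + m); together with the parity
   information in the equality case they show that either e >= 2 min(n, m), or
   n = m = 3 and e >= 5, or e >= n + m - a - b for some a, b > 0 with
   3 a + b <= m and a + 3 b <= n.  In the last case a disjoint stars J(1, y)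
   and b disjoint stars J(x, 1) cover all rows and columns with
   n + m - a - b ones. *)
Require Import Defs.
From mathcomp Require Import all_boot all_order all_algebra.
From mathcomp Require Import zify.

Set Implicit Arguments.
Unset Strict Implicit.
Unset Printing Implicit Defensive.

(** * Row sums, column sums and transposition *)

Lemma row_sum_tr n m (M : 'M[bool]_(n, m)) j : row_sum (M^T)%R j = col_sum M j.
Proof. by apply: eq_bigr => i _; rewrite mxE. Qed.

Lemma col_sum_tr n m (M : 'M[bool]_(n, m)) i : col_sum (M^T)%R i = row_sum M i.
Proof. by apply: eq_bigr => j _; rewrite mxE. Qed.

Lemma num_ones_row n m (M : 'M[bool]_(n, m)) : num_ones M = \sum_i row_sum M i.
Proof. by []. Qed.

Lemma num_ones_col n m (M : 'M[bool]_(n, m)) : num_ones M = \sum_j col_sum M j.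
Proof. exact: exchange_big. Qed.

Lemma num_ones_tr n m (M : 'M[bool]_(n, m)) : num_ones (M^T)%R = num_ones M.
Proof. by rewrite num_ones_col; apply: eq_bigr => i _; rewrite col_sum_tr. Qed.

Lemma kTDS_tr k n m (M : 'M[bool]_(n, m)) : kTDS k M -> kTDS k (M^T)%R.
Proof.
by move=> hM j i; rewrite /kappa row_sum_tr col_sum_tr mxE addnC; apply: hM.
Qed.

Lemma kTDS_one k n m (M : 'M[bool]_(n, m)) i j :
  kTDS k M -> M i j -> k.+2 <= row_sum M i + col_sum M j.
Proof.
move=> hM Mij; have := hM i j; rewrite /kappa Mij.
have ri : 0 < row_sum M i by rewrite /row_sum (bigD1 j) //= Mij.
have cj : 0 < col_sum M j by rewrite /col_sum (bigD1 i) //= Mij.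
lia.
Qed.

Lemma zero_row_ones k n m (M : 'M[bool]_(n, m)) i :
  kTDS k M -> row_sum M i = 0 -> k * m <= num_ones M.
Proof.
move=> hM ri0; rewrite num_ones_col mulnC -[m in m * k]card_ord -sum_nat_const.
by apply: leq_sum => j _; have := hM i j; rewrite /kappa ri0; lia.
Qed.

(** * Lower bounds on the number of ones by counting *)

Definition rows_of_sum n m (M : 'M[bool]_(n, m)) (P : pred nat) : nat :=
  \sum_i P (row_sum M i).

Lemma row_count_split n m (M : 'M[bool]_(n, m)) :
  (forall i, 0 < row_sum M i) ->
  n = rows_of_sum M (pred1 1) + rows_of_sum M (pred1 2) + rows_of_sum M (leq 3).
Proof.
move=> hr; rewrite -[LHS]card_ord -sum1_card -!big_split /=.
by apply: eq_bigr => i _; case: (row_sum M i) (hr i) => [|[|[|]]].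
Qed.

Lemma row_count_ones n m (M : 'M[bool]_(n, m)) :
  rows_of_sum M (pred1 1) + 2 * rows_of_sum M (pred1 2)
    + 3 * rows_of_sum M (leq 3) <= num_ones M.
Proof.
rewrite num_ones_row /rows_of_sum !big_distrr -!big_split /=; apply: leq_sum => i _.
by case: (row_sum M i) => [|[|[|k]]] /=; lia.
Qed.

(** The single one of a column of sum 1 lies in a row of sum at least 3, so the rows of sum at least
    3 contain at least as many ones as there are such columns. The rows of sum 1 and 2 contribute
    the other two terms. *)
Lemma leaf_ones n m (M : 'M[bool]_(n, m)) :
  kTDS 2 M ->
  rows_of_sum M (pred1 1) + rows_of_sum (M^T)%R (pred1 1)
    + 2 * rows_of_sum M (pred1 2) <= num_ones M.
Proof.
move=> hM.
have leaf : rows_of_sum (M^T)%R (pred1 1) <=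
    \sum_i (3 <= row_sum M i) * row_sum M i.
  rewrite /row_sum.
  under [X in _ <= X]eq_bigr => i _ do rewrite big_distrr /=.
  rewrite exchange_big /=; apply: leq_sum => j _; rewrite row_sum_tr.
  rewrite /=; have [cj|//] := eqVneq (col_sum M j) 1.
  have [/existsP [i Mij]|] := boolP [exists i, M i j].
    have := kTDS_one hM Mij; rewrite cj addn1 !ltnS => ri.
    by rewrite (bigD1 i) //= Mij; move: ri; rewrite /row_sum => ->.
  rewrite negb_exists => /forallP M0; move: cj; rewrite /col_sum big1 // => i _.
  by rewrite (negPf (M0 i)).
rewrite addnAC; apply: leq_trans (leq_add (leqnn _) leaf) _.
rewrite num_ones_row /rows_of_sum !big_distrr -!big_split /=; apply: leq_sum => i _.
by case: (row_sum M i) => [|[|[|k]]] //=; rewrite mul1n.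
Qed.

Lemma covered_cases n m (M : 'M[bool]_(n, m)) :
  1 < n -> 1 < m -> kTDS 2 M ->
  (forall i, 0 < row_sum M i) -> (forall j, 0 < col_sum M j) ->
  [\/ 2 * n <= num_ones M, 2 * m <= num_ones M,
      [/\ n = 3, m = 3 & 5 <= num_ones M] |
      exists a b, [/\ 0 < a, 0 < b, 3 * a + b <= m, a + 3 * b <= n &
                      n + m <= num_ones M + a + b]].
Proof.
move=> n1 m1 hM hr hc.
have hc' j : 0 < row_sum (M^T)%R j by rewrite row_sum_tr.
have := row_count_split hr; have := row_count_split hc'.
have := row_count_ones M; have := row_count_ones (M^T)%R.
have := leaf_ones hM; have := leaf_ones (kTDS_tr hM).
rewrite trmxK num_ones_tr.
move: (num_ones M) (rows_of_sum _ _) (rows_of_sum _ _) (rows_of_sum _ _)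
  (rows_of_sum _ _) (rows_of_sum _ _) (rows_of_sum _ _).
clear -n1 m1 => e x1 y1 x2 y2 x3 y3 H1 H2 H3 H4 H5 H6.
have [?|en] := leqP (2 * n) e; first by constructor 1.
have [?|em] := leqP (2 * m) e; first by constructor 2.
have [[-> ->]|n3] : n = 3 /\ m = 3 \/ ~ (n = 3 /\ m = 3) by lia.
  by constructor 3; split=> //; lia.
constructor 4.
have [e1|e1] : n + m = e + 1 \/ e + 2 <= n + m by lia.
  (* Here [e < 2 * n] and [e < 2 * m] force [n = m]. The size 2 would give equality in all the
     inequalities and fails by parity, and 3 is set aside, so [n] is at least 4. *)
  by exists 1, 1; split=> //; lia.
(* With [a + b = t], the two size conditions read [t + 2 * a <= m] and [t + 2 * b <= n]. The largest
   [a] that satisfies the first and leaves [b] positive is taken. The rounding could only hurt if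
   [n + m = 4 * t] with [m - t] odd; but then the counting inequalities are equalities, which makes
   [m - t] even. *)
pose t := n + m - e; pose a := minn ((m - t)./2) t.-1.
by exists a, (t - a); split; rewrite /a /t; lia.
Qed.

(** * Connectivity in [Gamma] and components of colour matrices *)

(** Induction on the distance of the positions: two elements of [Q] that are not adjacent have a
    third one strictly between them, at smaller distance from both. It is applied to the ones of a
    single row or column. *)
Lemma connect_between (T : finType) (e : rel T) (p : T -> nat) (Q : pred T) :
  {in Q &, injective p} ->
  {in Q &, forall u v, u != v ->
     e u v \/ exists2 w, w \in Q & strictly_between (p u) (p w) (p v)} ->
  {in Q &, forall u v, connect e u v}.
Proof.
(* The sum of the two truncated differences is the absolute difference. *)
move=> inj_p btw u v; have [k] := ubnP ((p u - p v) + (p v - p u)).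
elim: k u v => // k IH u v lt_k Qu Qv.
have [->|ne_uv] := eqVneq u v; first exact: connect0.
have [uv|[w Qw]] := btw _ _ Qu Qv ne_uv; first exact: connect1.
rewrite /strictly_between => /orP lt_w.
by apply: (@connect_trans _ _ w); apply: IH => //; lia.
Qed.

Lemma connect_row n m (M : 'M[bool]_(n, m)) (u v : ones M) :
  (val u).1 = (val v).1 -> connect (@Gamma n m M) u v.
Proof.
move=> eq_uv; pose Q := [pred w : ones M | (val w).1 == (val u).1].
apply: (@connect_between _ _ (fun w : ones M => (val w).2) Q);
  rewrite ?inE ?eq_uv ?eqxx //.
  move=> w w' /eqP e1 /eqP e1' /val_inj e2; apply: val_inj.
  by rewrite (surjective_pairing (val w)) e1 -e1' e2 -surjective_pairing.
move=> [[i j] Mij] [[i' j'] Mij']; rewrite !inE /= => /eqP ei /eqP ei'.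
subst i i' => ne; rewrite /Gamma /= eqxx /=.
have -> /= : j != j'.
  by apply: contraNneq ne => ej; apply/eqP/val_inj; rewrite /= ej.
case: forallP => [_|/forallP /forallPn [l]]; first by left.
rewrite negb_imply negbK => /andP[lt_l Ml]; right.
by exists (exist (fun p => M p.1 p.2) ((val u).1, l) Ml); rewrite ?inE /=.
Qed.

Lemma connect_col n m (M : 'M[bool]_(n, m)) (u v : ones M) :
  (val u).2 = (val v).2 -> connect (@Gamma n m M) u v.
Proof.
move=> eq_uv; pose Q := [pred w : ones M | (val w).2 == (val u).2].
apply: (@connect_between _ _ (fun w : ones M => (val w).1) Q);
  rewrite ?inE ?eq_uv ?eqxx //.
  move=> w w' /eqP e1 /eqP e1' /val_inj e2; apply: val_inj.
  by rewrite (surjective_pairing (val w)) e1 -e1' e2 -surjective_pairing.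
move=> [[i j] Mij] [[i' j'] Mij']; rewrite !inE /= => /eqP ej /eqP ej'.
subst j j' => ne; rewrite /Gamma /= eqxx /=.
have -> /= : i != i'.
  by apply: contraNneq ne => ei; apply/eqP/val_inj; rewrite /= ei.
case: (boolP [forall l, _]) => [_|/forallPn [l]]; first by left; rewrite orbT.
rewrite negb_imply negbK => /andP[lt_l Ml]; right.
by exists (exist (fun p => M p.1 p.2) (l, (val u).2) Ml); rewrite ?inE /=.
Qed.

(* Every matrix of the theorem but B(3,3) is of this form: the components are
   the full blocks of rows and columns of equal colour, and a row or column
   whose colour does not occur on the other side is zero. *)
Definition colour_mx n m (f : 'I_n -> nat) (g : 'I_m -> nat) : 'M[bool]_(n, m) :=
  (\matrix_(i, j) (f i == g j))%R.

Definition colour_class n (f : 'I_n -> nat) (k : nat) : {set 'I_n} :=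
  [set i | f i == k].

Lemma row_sum_colour n m (f : 'I_n -> nat) (g : 'I_m -> nat) i :
  row_sum (colour_mx f g) i = #|colour_class g (f i)|.
Proof.
rewrite -sum1dep_card big_mkcond; apply: eq_bigr => j _.
by rewrite mxE eq_sym; case: eqP.
Qed.

Lemma col_sum_colour n m (f : 'I_n -> nat) (g : 'I_m -> nat) j :
  col_sum (colour_mx f g) j = #|colour_class f (g j)|.
Proof.
rewrite -sum1dep_card big_mkcond; apply: eq_bigr => i _.
by rewrite mxE; case: eqP.
Qed.

(** The row and the column of a one have the same colour, so each edge preserves the colour.
    Conversely, for two ones of equal colour the cell in the row of the first and the column of the
    second is a one, and it joins them. *)
Lemma colour_mx_connect n m (f : 'I_n -> nat) (g : 'I_m -> nat)
    (u v : ones (colour_mx f g)) :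
  connect (@Gamma _ _ (colour_mx f g)) u v = (f (val u).1 == f (val v).1).
Proof.
have colE (w : ones (colour_mx f g)) : f (val w).1 = g (val w).2.
  by have := valP w; rewrite mxE => /eqP.
apply/idP/eqP => [|eq_uv].
  case/connectP => p + ->; elim: p u => //= w p IH u /andP[uw /IH <-].
  move: uw (colE u) (colE w) => {IH}.
  case: u w => [[i j] Mu] [[i' j'] Mw]; rewrite /Gamma /=.
  by case/orP => /and3P[/eqP <- _ _] => [//|-> ->].
have Mw : colour_mx f g (val u).1 (val v).2 by rewrite mxE eq_uv colE.
pose w : ones (colour_mx f g) :=
  exist (fun p => colour_mx f g p.1 p.2) ((val u).1, (val v).2) Mw.
by apply: (@connect_trans _ _ w); [apply: connect_row | apply: connect_col].
Qed.

Lemma perm_equiv_J n m (M : 'M[bool]_(n, m)) x y :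
  n = x -> m = y -> (forall i j, M i j) -> perm_equiv M (J x y).
Proof.
move=> <- <- M1; exists id, id; split; try exact: inv_bij.
by apply/matrixP => i j; rewrite !mxE; apply: M1.
Qed.

Lemma colour_mx_component n m (f : 'I_n -> nat) (g : 'I_m -> nat) C :
  C \in components (colour_mx f g) ->
  exists i j, [/\ f i = g j, #|comp_rows C| = #|colour_class f (f i)|,
    #|comp_cols C| = #|colour_class g (f i)| & forall r c, comp_mx C r c].
Proof.
case/imsetP => u _ ->; set D := [set _ in _ | _].
have colE (w : ones (colour_mx f g)) : f (val w).1 = g (val w).2.
  by have := valP w; rewrite mxE => /eqP.
have inD w : (w \in D) = (f (val u).1 == f (val w).1).
  by rewrite !inE colour_mx_connect.
have rowsE : comp_rows D = colour_class f (f (val u).1).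
  apply/setP => i; rewrite [RHS]inE; apply/imsetP/eqP => [[w]|fi].
    by rewrite inD => /eqP -> ->.
  have Mi : colour_mx f g i (val u).2 by rewrite mxE fi colE.
  by exists (exist (fun p => colour_mx f g p.1 p.2) (i, (val u).2) Mi); rewrite // inD fi.
have colsE : comp_cols D = colour_class g (f (val u).1).
  apply/setP => j; rewrite [RHS]inE; apply/imsetP/eqP => [[w]|gj].
    by rewrite inD => /eqP -> ->.
  have Mj : colour_mx f g (val u).1 j by rewrite mxE gj.
  by exists (exist (fun p => colour_mx f g p.1 p.2) ((val u).1, j) Mj); rewrite // inD.
exists (val u).1, (val u).2; split; rewrite ?rowsE ?colsE //.
move=> r c; rewrite !mxE.
have := enum_valP r; have := enum_valP c.
by rewrite {2}rowsE {2}colsE !inE => /eqP -> /eqP ->.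
Qed.

(** * Colourings with admissible blocks *)

Definition comp_size (x y : nat) : bool :=
  [|| (3 <= x) && (y == 1), (x == 1) && (3 <= y),
      (2 <= x) && (y == 2) | (x == 2) && (2 <= y)].

Lemma comp_sizeC x y : comp_size x y = comp_size y x.
Proof. by rewrite /comp_size; lia. Qed.

Definition good_components n m (M : 'M[bool]_(n, m)) : Prop :=
  forall C, C \in components M ->
    [\/ exists x, 3 <= x /\ perm_equiv (comp_mx C) (J x 1),
        exists y, 3 <= y /\ perm_equiv (comp_mx C) (J 1 y),
        exists x, 2 <= x /\ perm_equiv (comp_mx C) (J x 2) |
        exists y, 2 <= y /\ perm_equiv (comp_mx C) (J 2 y)].

(** In the colour matrix [#|colour_class g (f i)|] is a row sum and [#|colour_class f (g j)|] a
    column sum, so the second branch is the 2TDS condition at a zero cell. At a one, an admissible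
    block has sides adding up to at least 4, which gives the condition there. *)
Definition good_colouring n m (f : 'I_n -> nat) (g : 'I_m -> nat) : Prop :=
  forall i j,
    if f i == g j then comp_size #|colour_class f (f i)| #|colour_class g (f i)|
    else 2 <= #|colour_class g (f i)| + #|colour_class f (g j)|.

Lemma good_colouring_components n m (f : 'I_n -> nat) (g : 'I_m -> nat) :
  good_colouring f g -> good_components (colour_mx f g).
Proof.
move=> fg C /colour_mx_component [i [j [fg_ij Ex Ey C1]]].
have := fg i j; rewrite fg_ij eqxx -fg_ij -Ex -Ey => /or4P[] /andP[].
- move=> x3 /eqP y1; constructor 1; exists #|comp_rows C|.
  by split=> //; apply: perm_equiv_J.
- move=> /eqP x1 y3; constructor 2; exists #|comp_cols C|.
  by split=> //; apply: perm_equiv_J.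
- move=> x2 /eqP y2; constructor 3; exists #|comp_rows C|.
  by split=> //; apply: perm_equiv_J.
- move=> /eqP x2 y2; constructor 4; exists #|comp_cols C|.
  by split=> //; apply: perm_equiv_J.
Qed.

Lemma good_colouring_kTDS n m (f : 'I_n -> nat) (g : 'I_m -> nat) :
  good_colouring f g -> kTDS 2 (colour_mx f g).
Proof.
move=> fg i j; rewrite /kappa row_sum_colour col_sum_colour mxE.
have := fg i j; case: eqP => [<-|_]; rewrite /comp_size; lia.
Qed.

(** An upper bound suffices: when [e] is the minimum over all 2TDS matrices, the colour matrix
    attains it. *)
Definition coloured n m e : Prop :=
  exists (f : 'I_n -> nat) (g : 'I_m -> nat),
    good_colouring f g /\ num_ones (colour_mx f g) <= e.

Lemma coloured_sym n m e : coloured n m e -> coloured m n e.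
Proof.
move=> [f [g [fg le_e]]]; exists g, f; split.
  move=> j i; have := fg i j; rewrite eq_sym.
  by case: eqP => [->|_]; rewrite 1?comp_sizeC 1?addnC.
suff -> : colour_mx g f = (colour_mx f g)^T%R by rewrite num_ones_tr.
by apply/matrixP => j i; rewrite !mxE eq_sym.
Qed.

(** * Constructions: full rows and disjoint stars *)

Lemma coloured_rows k n m :
  2 <= k <= n -> comp_size k m -> coloured n m (k * m).
Proof.
(* The boolean serves as a colour: the first [k] rows share colour 0 with every column, and the
   other rows get colour 1 and are zero. *)
move=> /andP[k2 kn] km; exists (fun i => k <= i), (fun _ : 'I_m => 0).
have cf : #|colour_class (fun i : 'I_n => k <= i : nat) 0| = k.
  rewrite -sum1dep_card (eq_bigl (fun i : 'I_n => i < k)); last first.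
    by move=> i /=; rewrite ltnNge eqb0.
  by rewrite (big_ord_narrow kn) sum1_card card_ord.
have cg : #|colour_class (fun _ : 'I_m => 0) 0| = m.
  by rewrite -sum1dep_card sum1_card card_ord.
split.
  move=> i j /=; case: (leqP k i) => _ /=; rewrite ?cf ?cg //.
  by rewrite (leq_trans k2) ?leq_addl.
rewrite num_ones_col mulnC -[m in m * k]card_ord -sum_nat_const.
by apply: leq_sum => j _; rewrite col_sum_colour cf.
Qed.

(* The a first indices get the a distinct colours from c on; the others cycle
   through the b colours from d on, each used at least 3 times as soon as
   at least 3 b indices remain. *)
Definition star_colour (c a d b i : nat) : nat :=
  if i < a then c + i else d + (i - a) %% b.

(** The condition on [c] and [d] keeps the two ranges of colours disjoint, so [c + k] occurs at
    index [k] only. *)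
Lemma star_colour_single c a d b n k :
  a <= n -> 0 < b -> c + a <= d \/ d + b <= c -> k < a ->
  #|colour_class (fun i : 'I_n => star_colour c a d b i) (c + k)| = 1.
Proof.
move=> an b0 cd ka; apply/eqP/cards1P; exists (Ordinal (leq_trans ka an)).
apply/setP => i; rewrite !inE -val_eqE /= /star_colour.
by have := ltn_pmod (i - a) b0; case: (ltnP i a); lia.
Qed.

Lemma star_colour_triple c a d b n k :
  a + 3 * b <= n -> k < b ->
  3 <= #|colour_class (fun i : 'I_n => star_colour c a d b i) (d + k)|.
Proof.
move=> abn kb.
(* Three occurrences of the colour, one in each of the first three rounds of the cycle. *)
have lt_n (t : 'I_3) : a + (t * b + k) < n by have := ltn_ord t; nia.
have inj : injective (fun t => Ordinal (lt_n t)).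
  by move=> t t' [eq_t]; apply: val_inj => /=; nia.
rewrite -[3]card_ord -(card_imset _ inj); apply: subset_leq_card.
apply/subsetP => _ /imsetP[t _ ->]; rewrite inE /star_colour /=.
by rewrite ltnNge leq_addr /= addKn modnMDl modn_small.
Qed.

Lemma sum_leq_ord a n : \sum_(i < n) (a <= i) = n - a.
Proof.
elim: n => [|n IH]; first by rewrite big_ord0.
by rewrite big_ord_recr /= IH; case: leqP; lia.
Qed.

Lemma coloured_stars n m a b :
  0 < a -> 0 < b -> 3 * a + b <= m -> a + 3 * b <= n ->
  coloured n m ((n - a) + (m - b)).
Proof.
move=> a0 b0 abm abn.
(* Each colour below [a] is used by one row and at least three columns, a star J(1, y); each colour
   from [a] to [a + b - 1] by one column and at least three rows, a star J(x, 1). *)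
pose f (i : 'I_n) := star_colour 0 a a b i.
pose g (j : 'I_m) := star_colour a b 0 a j.
have fP i : f i < a + b.
  by rewrite /f /star_colour; have := ltn_pmod (i - a) b0; case: (ltnP i a); lia.
have gP j : g j < a + b.
  by rewrite /g /star_colour; have := ltn_pmod (j - b) a0; case: (ltnP j b); lia.
have low k : k < a -> #|colour_class f k| = 1 /\ 3 <= #|colour_class g k|.
  move=> ka; split; first by apply: (@star_colour_single 0 a a b n k) => //; lia.
  by apply: (@star_colour_triple a b 0 a m k) => //; lia.
have high k : a <= k < a + b -> 3 <= #|colour_class f k| /\ #|colour_class g k| = 1.
  move=> /andP[ak kab]; rewrite -(subnKC ak); split.
    by apply: (@star_colour_triple 0 a a b n) => //; lia.
  by apply: (@star_colour_single a b 0 a m) => //; lia.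
exists f, g; split.
  move=> i j; have := fP i; have := gP j; move: (f i) (g j) => k l lab kab.
  have := low k; have := high k; have := low l; have := high l.
  by rewrite /comp_size; case: eqP => [->|_]; case: (ltnP l a); case: (ltnP k a); lia.
(* The first [a] rows have colours below [a] and the first [b] columns colours from [a] on, so their
   common cells are zero. Every one thus lies in a later row or a later column, and all of these
   have sum 1. *)
have half : num_ones (colour_mx f g) <=
    \sum_(i < n) (a <= i) * row_sum (colour_mx f g) i
    + \sum_(j < m) (b <= j) * col_sum (colour_mx f g) j.
  under eq_bigr => i _ do rewrite big_distrr /=.
  under [X in _ <= _ + X]eq_bigr => j _ do rewrite big_distrr /=.
  rewrite [X in _ <= _ + X]exchange_big -big_split /=; apply: leq_sum => i _.
  rewrite -big_split /=; apply: leq_sum => j _.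
  by rewrite mxE /f /g /star_colour; case: (ltnP i a); case: (ltnP j b); lia.
apply: (leq_trans half); rewrite -(sum_leq_ord a n) -(sum_leq_ord b m).
apply: leq_add; apply: leq_sum => i _.
  case: (leqP a i) => // ai; rewrite mul1n.
  rewrite row_sum_colour; case: (high (f i)) => [|_ -> //].
  by rewrite fP andbT /f /star_colour (leq_gtF ai) leq_addr.
case: (leqP b i) => // ai; rewrite mul1n.
rewrite col_sum_colour; case: (low (g i)) => [|-> //].
by rewrite /g /star_colour (leq_gtF ai) ltn_pmod.
Qed.

(** * Comparison of an arbitrary 2TDS matrix with a colouring *)

Lemma kTDS_single_row m (M : 'M[bool]_(1, m)) :
  0 < m -> kTDS 2 M -> 3 <= num_ones M.
Proof.
case: m M => // m M _ hM.
have eM : num_ones M = row_sum M ord0 by rewrite /num_ones big_ord1.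
have cE j : col_sum M j = M ord0 j by rewrite /col_sum big_ord1.
have [/existsP [j Mj]|] := boolP [exists j, M ord0 j].
  by have := kTDS_one hM Mj; rewrite cE Mj eM addn1.
rewrite negb_exists => /forallP M0.
have := hM ord0 ord0; rewrite /kappa cE (negPf (M0 _)) /row_sum big1 // => j _.
by rewrite (negPf (M0 j)).
Qed.

Lemma coloured_mono n m e e' : e <= e' -> coloured n m e -> coloured n m e'.
Proof.
by move=> le_e [f [g [fg le_fg]]]; exists f, g; split=> //; apply: leq_trans le_e.
Qed.

Lemma coloured_single_row m e : 3 <= m -> 3 <= e -> coloured 1 m e.
Proof.
move=> m3 /coloured_mono; apply; apply: coloured_sym.
exact: (@coloured_rows 3 m 1).
Qed.

(** This matches each lower bound with its construction: three ones for a single row or column, two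
    full rows or columns, or disjoint stars. Only the 3 x 3 case with at least 5 ones is left to
    B(3,3). *)
Lemma kTDS_coloured n m (M : 'M[bool]_(n, m)) :
  0 < n -> 0 < m -> 4 <= n + m -> kTDS 2 M ->
  coloured n m (num_ones M) \/ [/\ n = 3, m = 3 & 5 <= num_ones M].
Proof.
move=> n0 m0 nm hM.
have [n1|n1] := leqP n 1.
  left; have En : n = 1 by lia.
  subst n; apply: coloured_single_row; [lia | exact: kTDS_single_row].
have [m1|m1] := leqP m 1.
  left; have Em : m = 1 by lia.
  subst m; apply/coloured_sym/coloured_single_row; first lia.
  by rewrite -num_ones_tr; apply: kTDS_single_row (kTDS_tr hM).
have rows : 2 * m <= num_ones M -> coloured n m (num_ones M).
  move/coloured_mono; apply; apply: coloured_rows => //.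
  by rewrite /comp_size m1 !orbT.
have cols : 2 * n <= num_ones M -> coloured n m (num_ones M).
  move/coloured_mono; apply; apply/coloured_sym/coloured_rows => //.
  by rewrite /comp_size n1 !orbT.
have [/existsP [i /eqP ri]|] := boolP [exists i, row_sum M i == 0].
  by left; apply/rows/(zero_row_ones hM ri).
rewrite negb_exists => /forallP r0.
have [/existsP [j /eqP cj]|] := boolP [exists j, col_sum M j == 0].
  left; apply: cols; rewrite -num_ones_tr.
  by apply: (@zero_row_ones _ _ _ _ j (kTDS_tr hM)); rewrite row_sum_tr.
rewrite negb_exists => /forallP c0.
have r1 i : 0 < row_sum M i by rewrite lt0n.
have c1 j : 0 < col_sum M j by rewrite lt0n.
case: (covered_cases n1 m1 hM r1 c1) => [/cols|/rows||]; [by left..|by right|].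
case=> [a [b [a0 b0 abm abn le_nm]]]; left; apply: coloured_mono (coloured_stars a0 b0 abm abn); lia.
Qed.

(** * The matrix B(3,3), existence of a minimum, and the conclusion *)

Lemma B33_kTDS : kTDS 2 B33.
Proof.
move=> i j; rewrite /kappa /row_sum /col_sum !big_ord_recl !big_ord0 !mxE.
by case: i => [[|[|[|//]]] ?]; case: j => [[|[|[|//]]] ?].
Qed.

Lemma num_ones_B33 : num_ones B33 = 5.
Proof. by rewrite /num_ones !big_ord_recl !big_ord0 !mxE. Qed.

Lemma kTDS_full n m : 4 <= n + m -> kTDS 2 (J n m).
Proof.
move=> nm i j; rewrite /kappa /row_sum /col_sum.
under eq_bigr do rewrite mxE.
under [X in _ + X]eq_bigr do rewrite mxE.
by rewrite !sum1_card !card_ord mxE; lia.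
Qed.

Lemma exists_min_kTDS n m : 4 <= n + m -> exists M : 'M[bool]_(n, m), min_kTDS 2 M.
Proof.
move=> nm; pose P (M : 'M[bool]_(n, m)) := [forall i, forall j, 2 <= kappa M i j].
have PP M : reflect (kTDS 2 M) (P M).
  by apply: (iffP 'forall_forallP) => hM.
have P0 : P (J n m) by apply/PP/kTDS_full.
case: (arg_minnP (@num_ones n m) P0) => M /PP hM min_M.
by exists M; split=> // M' /PP /min_M.
Qed.

Theorem theorem7 (n m : nat) (hn : 1 <= n) (hm : 1 <= m)
    (hnm : (n, m) \notin [:: (1, 1); (1, 2); (2, 1)]) :
  exists M : 'M[bool]_(n, m),
    min_kTDS 2 M /\
    (perm_equiv M B33 \/
     forall C, C \in components M ->
       [\/ exists x, 3 <= x /\ perm_equiv (comp_mx C) (J x 1),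
           exists y, 3 <= y /\ perm_equiv (comp_mx C) (J 1 y),
           exists x, 2 <= x /\ perm_equiv (comp_mx C) (J x 2) |
           exists y, 2 <= y /\ perm_equiv (comp_mx C) (J 2 y)]).
Proof.
(* The excluded formats are exactly those with [n + m <= 3]. *)
have nm : 4 <= n + m by move: hnm; rewrite !inE !xpair_eqE; lia.
have [M0 [hM0 min_M0]] := exists_min_kTDS nm.
have [[f [g [fg le_fg]]]|[n3 m3 le5]] := kTDS_coloured hn hm nm hM0.
  exists (colour_mx f g); split; last by right; apply: good_colouring_components.
  split; first exact: good_colouring_kTDS.
  by move=> M' /min_M0; apply: leq_trans.
(* The minimum is at least 5 here, and B(3,3) has exactly 5 ones. *)
subst n m; exists B33; split; last first.
  left; exists id, id; split; try exact: inv_bij.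
  by apply/matrixP => i j; rewrite !mxE.
split; first exact: B33_kTDS.
by move=> M' /min_M0; rewrite num_ones_B33; apply: leq_trans.
Qed.
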